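(* Let $\mathbb{F}$ be any field and $M\in\mathbb{F}^{2\times 2}$. There is a constant $\varepsilon>0.01526$ such that, for every positive integer $n$, writing $N=2^n$, the matrix $M^{\otimes n}$ has a synchronous linear circuit over $\mathbb{F}$ of size at most $\big((1-\varepsilon)\cdot e\cdot\ln 2+o(1)\big)\cdot N\log_2 N$, where $o(1)\to0$ as $n\to\infty$. When $M=H_1=\begin{bmatrix}1&1\\1&-1\end{bmatrix}$ (so $M^{\otimes n}=H_n$, the Walsh–Hadamard transform) the same holds with some $\varepsilon>0.04816$.
   Context: Kronecker power $M^{\otimes n}$ as usual. A synchronous linear circuit (of any depth $d$) for a matrix $A$ is a factorization $A=A_1\times\cdots\times A_d$, whose size is $\sum_j\mathrm{nnz}(A_j)$, where $\mathrm{nnz}$ counts nonzero entries. *)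

(* Defs.v *)
From HB Require Import structures.
From mathcomp Require Import all_boot all_order all_algebra.
From mathcomp Require Import all_classical all_reals all_analysis.
Set Implicit Arguments. Unset Strict Implicit. Unset Printing Implicit Defensive.
Import Order.TTheory GRing.Theory Num.Theory.
Local Open Scope ring_scope.

Definition bit (k i : nat) : 'I_2 := inord (odd (i %/ 2 ^ k)).

(* Kronecker power M^{(x)n} : 'M_(2^n), with (i,j) entry
   prod_{k<n} M (bit_k i) (bit_k j)  (digit 0 = last tensor factor). *)
Definition kron_pow (F : ringType) (M : 'M[F]_2) (n : nat) : 'M[F]_(2 ^ n) :=
  \matrix_(i, j) \prod_(k < n) M (bit k i) (bit k j).

Definition nnz (F : ringType) (m n : nat) (A : 'M[F]_(m, n)) : nat :=
  #|[set ij : 'I_m * 'I_n | A ij.1 ij.2 != 0]|.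

Inductive sync_circuit (F : ringType) : forall m n : nat, 'M[F]_(m, n) -> nat -> Prop :=
| sc_one m n (A : 'M[F]_(m, n)) : sync_circuit A (nnz A)
| sc_cons m k n (B : 'M[F]_(m, k)) (C : 'M[F]_(k, n)) s :
    sync_circuit C s -> sync_circuit (B *m C) (nnz B + s)%N.

Definition H1 (F : ringType) : 'M[F]_2 :=
  \matrix_(i, j) (if (i == 1 :> nat) && (j == 1 :> nat) then -1 else 1).

(* Main.v *)
Require Import Defs.
From HB Require Import structures.
From mathcomp Require Import all_boot all_order all_algebra.
From mathcomp Require Import all_classical all_reals all_analysis.
From mathcomp Require Import zify ring lra.
Set Implicit Arguments. Unset Strict Implicit. Unset Printing Implicit Defensive.
Import Order.TTheory GRing.Theory Num.Theory.
Import numFieldNormedType.Exports.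
Local Open Scope ring_scope.

(* If M has a zero entry, treating one tensor factor per layer costs (3/2) N n.  Otherwise
   M (x) M = B A, where A (4 x 4) has one full row and three unit rows, and B has 10 nonzero
   entries.  Spread over w layers, B^(x w) costs (5/2) w 4^w.  For A^(x w) the letters of an
   output word that correspond to unit rows need no work, so each layer handles just the next
   full-row letter of each word, at 4 entries per word; a typical word contains w/4 such
   letters, and about (3/10) w of these layers serve all words but an exponentially small
   fraction, which is finished by (1/50) w coarse layers of 50 letters each.  A layer in which
   a word is idle costs 1 entry instead of 4, so the total for A^(x w) is
   (3/4 + 3/10 + 1/50) w 4^w up to lower order, hence for M^(x n), with n = 2 w,
   (5/2 + 107/100) / 2 = 1.785 per unit of N n, and 1.785 < (19/20) e ln 2. *)

(** * Layered circuits over finite types *)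

Section LayeredCircuits.
Context {F : fieldType}.

(** Matrices are functions on finite types, so that products, sums and options of index sets serve
    as indices without renumbering. *)
Definition fnnz (I J : finType) (f : I -> J -> F) : nat :=
  #|[set ij : I * J | f ij.1 ij.2 != 0]|.

(* Exactly [d.+1] factors of total size at most [s]: keeping track of the exact number of
   layers is what lets [layers_stack] run circuits side by side. *)
Fixpoint layers (d : nat) : forall I J : finType, (I -> J -> F) -> nat -> Prop :=
  match d with
  | 0 => fun I J f s => (fnnz f <= s)%N
  | d'.+1 => fun I J f s => exists (K : finType) (B : I -> K -> F) (C : K -> J -> F) (s' : nat),
      [/\ layers d' B s', (s' + fnnz C <= s)%N & forall i j, f i j = \sum_k B i k * C k j]
  end.

Definition idm (I : finType) (i j : I) : F := (i == j)%:R.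
Definition tensor (I J I' J' : finType) (f : I -> J -> F) (g : I' -> J' -> F)
  (i : I * I') (j : J * J') : F := f i.1 j.1 * g i.2 j.2.

Lemma fnnzE (I J : finType) (f : I -> J -> F) :
  fnnz f = (\sum_i \sum_j (f i j != 0%R))%N.
Proof.
rewrite /fnnz -sum1_card big_mkcond /= pair_bigA /=.
by apply: eq_bigr => -[i j] _; rewrite inE /=; case: eqP.
Qed.

Lemma fnnz_le_card (I J : finType) (f : I -> J -> F) : (fnnz f <= #|I| * #|J|)%N.
Proof. by rewrite -card_prod /fnnz; exact: max_card. Qed.

(** [c] is partial so that zero columns may be inserted at no cost; [ocancel] makes it injective
    where it is defined, so no nonzero entry is duplicated. *)
Lemma fnnz_reindex (I J I' J' : finType) (f : I -> J -> F) (f' : I' -> J' -> F)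
    (r : I' -> I) (r' : I -> I') (c : J' -> option J) (c' : J -> J') :
  cancel r r' -> ocancel c c' ->
  (forall i j, f' i j = if c j is Some j0 then f (r i) j0 else 0) ->
  (fnnz f' <= fnnz f)%N.
Proof.
move=> rK cK f'E; rewrite /fnnz.
pose h (ij : I * J) := (r' ij.1, c' ij.2).
apply: leq_trans (leq_imset_card h _); apply/subset_leq_card/fintype.subsetP => -[i j].
rewrite inE /= f'E; case cj: (c j) => [j0|]; last by rewrite eqxx.
move=> nz; apply/imsetP; exists (r i, j0); first by rewrite inE.
by rewrite /h /= rK; move: (cK j); rewrite cj /= => ->.
Qed.

Lemma fnnz_tensor (I J I' J' : finType) (f : I -> J -> F) (g : I' -> J' -> F) :
  fnnz (tensor f g) = (fnnz f * fnnz g)%N.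
Proof.
rewrite /fnnz -cardsX.
pose h (p : (I * J) * (I' * J')) := ((p.1.1, p.2.1), (p.1.2, p.2.2)).
have hI : injective h by move=> [[i j] [i' j']] [[k l] [k' l']] [-> -> -> ->].
rewrite -(card_imset _ hI); apply: eq_card => -[[i i'] [j j']].
rewrite inE /tensor /=; apply/idP/imsetP.
- rewrite mulf_eq0 negb_or => /andP[nf ng].
  by exists ((i, j), (i', j')); rewrite // inE /= !inE nf ng.
- case=> -[[k l] [k' l']]; rewrite inE /= !inE /= => /andP[nf ng] [-> -> -> ->].
  by rewrite mulf_neq0.
Qed.

Lemma fnnz_idm (I : finType) : fnnz (@idm I) = #|I|.
Proof.
rewrite fnnzE -sum1_card; apply: eq_bigr => i _.
rewrite (bigD1 i) //= big1 /idm ?eqxx ?oner_eq0 // => j /negPf ji.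
by rewrite [i == j]eq_sym ji eqxx.
Qed.

Lemma sum_idmr (I : finType) (f : I -> F) j : \sum_k f k * idm k j = f j.
Proof.
rewrite (bigD1 j) //= /idm eqxx mulr1 big1 ?addr0 // => k /negPf->.
by rewrite mulr0.
Qed.

Lemma sum_idml (I : finType) (f : I -> F) i : \sum_k idm i k * f k = f i.
Proof.
rewrite (bigD1 i) //= /idm eqxx mul1r big1 ?addr0 // => k.
by rewrite eq_sym => /negPf->; rewrite mul0r.
Qed.

Lemma layers_mono d (I J : finType) (f : I -> J -> F) s s' :
  (s <= s')%N -> layers d f s -> layers d f s'.
Proof.
case: d => [|d] /= les; first by move=> /leq_trans; exact.
move=> [K [B [C [s0 [lB sC fE]]]]]; exists K, B, C, s0; split=> //.
exact: leq_trans les.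
Qed.

(** Row renaming touches only the leftmost factor and column renaming only the rightmost one; the
    inner index sets stay as they are. *)
Lemma layers_reindex d (I J I' J' : finType) (f : I -> J -> F) (f' : I' -> J' -> F) s
    (r : I' -> I) (r' : I -> I') (c : J' -> option J) (c' : J -> J') :
  cancel r r' -> ocancel c c' ->
  (forall i j, f' i j = if c j is Some j0 then f (r i) j0 else 0) ->
  layers d f s -> layers d f' s.
Proof.
elim: d I J I' J' f f' s r r' c c' => [|d IHd] I J I' J' f f' s r r' c c' rK cK f'E /=.
  by apply: leq_trans; exact: fnnz_reindex rK cK f'E.
move=> [K [B [C [s0 [lB sC fE]]]]].
exists K, (fun i k => B (r i) k), (fun k j => if c j is Some j0 then C k j0 else 0), s0.
split.
- by apply: (IHd _ _ _ _ B _ _ r r' some id).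
- apply: leq_trans sC; rewrite leq_add2l.
  by apply: (@fnnz_reindex _ _ _ _ C _ id id c c').
- move=> i j; rewrite f'E; case: (c j) => [j0|//]; first by rewrite fE.
  by rewrite big1 // => k _; rewrite mulr0.
Qed.

Lemma layers_cons d (I J K : finType) (f : I -> J -> F) (B : I -> K -> F) (C : K -> J -> F) s s' :
  layers d B s -> (fnnz C <= s')%N -> (forall i j, f i j = \sum_k B i k * C k j) ->
  layers d.+1 f (s + s').
Proof. by move=> lB nC fE; exists K, B, C, s; split=> //; rewrite leq_add2l. Qed.

Lemma layers_pad d (I J : finType) (f : I -> J -> F) s :
  layers d f s -> layers d.+1 f (s + #|J|).
Proof.
move=> lf; apply: (layers_cons lf (C := @idm J)); first by rewrite fnnz_idm.
by move=> i j; rewrite sum_idmr.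
Qed.

Lemma layers_tensorl d (P I J : finType) (f : I -> J -> F) s :
  layers d f s -> layers d (tensor (@idm P) f) (#|P| * s).
Proof.
elim: d I J f s => [|d IHd] I J f s /=.
  by move=> nf; rewrite fnnz_tensor fnnz_idm leq_mul2l nf orbT.
move=> [K [B [C [s0 [lB sC fE]]]]].
exists (P * K)%type, (tensor (@idm P) B), (tensor (@idm P) C), (#|P| * s0)%N; split.
- exact: IHd.
- by rewrite fnnz_tensor fnnz_idm -mulnDr leq_mul2l sC orbT.
- move=> [p i] [q j]; rewrite /tensor /= fE -(pair_bigA _ (fun p' k =>
    idm p p' * B i k * (idm p' q * C k j))) /=.
  rewrite -(@sum_idml P (fun p' => idm p' q * _)).
  apply: eq_bigr => p' _; rewrite !mulr_sumr; apply: eq_bigr => k _.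
  by rewrite !mulrA; congr (_ * _); rewrite mulrAC.
Qed.

(** Mixed-product rule: the first coordinate is transformed on the input side, then the second. *)
Lemma tensor_factor (I J I' J' : finType) (f : I -> J -> F) (g : I' -> J' -> F) i j :
  tensor f g i j = \sum_k tensor (@idm I) g i k * tensor f (@idm J') k j.
Proof.
case: i j => [i i'] [j j'].
rewrite -(pair_bigA _ (fun k k' => tensor (@idm I) g (i, i') (k, k') *
  tensor f (@idm J') (k, k') (j, j'))) /= /tensor /=.
rewrite -(sum_idml (f^~ j)) mulr_suml; apply: eq_bigr => k _.
rewrite -(sum_idmr (g i')) !mulr_sumr; apply: eq_bigr => k' _ /=.
by rewrite !mulrA; congr (_ * _); rewrite mulrAC.
Qed.

(** * Direct sums and stacking of circuits *)

Definition dsum (I1 J1 I2 J2 : finType) (f1 : I1 -> J1 -> F) (f2 : I2 -> J2 -> F)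
    (i : I1 + I2) (j : J1 + J2) : F :=
  match i, j with inl i, inl j => f1 i j | inr i, inr j => f2 i j | _, _ => 0 end.

Definition stack (I1 I2 J : finType) (f1 : I1 -> J -> F) (f2 : I2 -> J -> F)
    (i : I1 + I2) (j : J) : F := match i with inl i => f1 i j | inr i => f2 i j end.

Lemma fnnz_stack (I1 I2 J : finType) (f1 : I1 -> J -> F) (f2 : I2 -> J -> F) :
  fnnz (stack f1 f2) = (fnnz f1 + fnnz f2)%N.
Proof. by rewrite !fnnzE big_sumType. Qed.

Lemma fnnz_dsum (I1 J1 I2 J2 : finType) (f1 : I1 -> J1 -> F) (f2 : I2 -> J2 -> F) :
  fnnz (dsum f1 f2) = (fnnz f1 + fnnz f2)%N.
Proof.
rewrite !fnnzE big_sumType /=; congr (_ + _)%N; apply: eq_bigr => i _.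
- by rewrite big_sumType /= [X in (_ + X)%N]big1 ?addn0 // => j _; rewrite eqxx.
- by rewrite big_sumType /= big1 // => j _; rewrite eqxx.
Qed.

Lemma layers_dsum d (I1 J1 I2 J2 : finType) (f1 : I1 -> J1 -> F) (f2 : I2 -> J2 -> F) s1 s2 :
  layers d f1 s1 -> layers d f2 s2 -> layers d (dsum f1 f2) (s1 + s2).
Proof.
elim: d I1 J1 I2 J2 f1 f2 s1 s2 => [|d IHd] I1 J1 I2 J2 f1 f2 s1 s2 /=.
  by move=> n1 n2; rewrite fnnz_dsum leq_add.
move=> [K1 [B1 [C1 [t1 [lB1 sC1 fE1]]]]] [K2 [B2 [C2 [t2 [lB2 sC2 fE2]]]]].
exists (K1 + K2)%type, (dsum B1 B2), (dsum C1 C2), (t1 + t2)%N; split.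
- exact: IHd.
- by rewrite fnnz_dsum addnACA leq_add.
- move=> [i|i] [j|j]; rewrite big_sumType /= ?fE1 ?fE2.
  + by rewrite [X in _ + X]big1 ?addr0 // => k _; rewrite mul0r.
  + by rewrite !big1 ?addr0 // => k _; rewrite ?mulr0 ?mul0r.
  + by rewrite !big1 ?addr0 // => k _; rewrite ?mulr0 ?mul0r.
  + by rewrite [X in X + _]big1 ?add0r // => k _; rewrite mul0r.
Qed.

(** Both circuits read the same inputs, so the rightmost factors are stacked; all the other layers
    are block diagonal. *)
Lemma layers_stack d (I1 I2 J : finType) (f1 : I1 -> J -> F) (f2 : I2 -> J -> F) s1 s2 :
  layers d f1 s1 -> layers d f2 s2 -> layers d (stack f1 f2) (s1 + s2).
Proof.
case: d => [|d] /=; first by move=> n1 n2; rewrite fnnz_stack leq_add.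
move=> [K1 [B1 [C1 [t1 [lB1 sC1 fE1]]]]] [K2 [B2 [C2 [t2 [lB2 sC2 fE2]]]]].
exists (K1 + K2)%type, (dsum B1 B2), (stack C1 C2), (t1 + t2)%N; split.
- exact: layers_dsum.
- by rewrite fnnz_stack addnACA leq_add.
- move=> [i|i] j; rewrite big_sumType /= ?fE1 ?fE2.
  + by rewrite [X in _ + X]big1 ?addr0 // => k _; rewrite mul0r.
  + by rewrite [X in X + _]big1 ?add0r // => k _; rewrite mul0r.
Qed.

(** * Circuits of unspecified depth *)

Definition circ (I J : finType) (f : I -> J -> F) (s : nat) : Prop := exists d, layers d f s.

Lemma circ_mono (I J : finType) (f : I -> J -> F) s s' :
  (s <= s')%N -> circ f s -> circ f s'.
Proof. by move=> les [d lf]; exists d; exact: layers_mono lf. Qed.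

Lemma circ_reindex (I J I' J' : finType) (f : I -> J -> F) (f' : I' -> J' -> F) s
    (r : I' -> I) (r' : I -> I') (c : J' -> J) (c' : J -> J') :
  cancel r r' -> cancel c c' -> (forall i j, f' i j = f (r i) (c j)) ->
  circ f s -> circ f' s.
Proof.
move=> rK cK f'E [d lf]; exists d.
exact: (@layers_reindex d _ _ _ _ f f' s r r' (some \o c) c').
Qed.

Lemma circ_one (I J : finType) (f : I -> J -> F) : circ f (fnnz f).
Proof. by exists 0%N => /=. Qed.

(** Induction on the depth of [C]: its rightmost factor becomes the rightmost one of the whole, and
    reassociation leaves [B] times a shallower circuit. *)
Lemma circ_mul (I J K : finType) (f : I -> J -> F) (B : I -> K -> F) (C : K -> J -> F) s s' :
  circ B s -> circ C s' -> (forall i j, f i j = \sum_k B i k * C k j) -> circ f (s + s').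
Proof.
move=> cB [d]; elim: d J f C s' => [|d IHd] J f C s' /=.
  by move=> nC fE; case: cB => d lB; exists d.+1; exact: layers_cons lB nC fE.
move=> [L [C1 [C2 [t [lC1 sC CE]]]]] fE.
have [e le] := IHd L (fun i l => \sum_k B i k * C1 k l) C1 t lC1 (fun _ _ => erefl).
exists e.+1; exists L, (fun i l => \sum_k B i k * C1 k l), C2, (s + t)%N; split=> //.
- by rewrite -addnA leq_add2l.
- move=> i j; rewrite fE.
  under [RHS]eq_bigr => l _ do rewrite mulr_suml.
  rewrite exchange_big /=; apply: eq_bigr => k _.
  by rewrite CE mulr_sumr; apply: eq_bigr => l _; rewrite mulrA.
Qed.

Lemma circ_tensorl (P I J : finType) (f : I -> J -> F) s :
  circ f s -> circ (tensor (@idm P) f) (#|P| * s).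
Proof. by move=> [d lf]; exists d; exact: layers_tensorl. Qed.

Lemma circ_tensorr (P I J : finType) (f : I -> J -> F) s :
  circ f s -> circ (tensor f (@idm P)) (s * #|P|).
Proof.
move=> /(circ_tensorl P); rewrite mulnC.
pose sw A B (x : A * B) := (x.2, x.1).
apply: (@circ_reindex _ _ _ _ _ _ _ (@sw _ _) (@sw _ _) (@sw _ _) (@sw _ _)) => [[]//|[]//|].
by move=> [i p] [j q]; rewrite /tensor /= mulrC.
Qed.

Lemma circ_tensor (I J I' J' : finType) (f : I -> J -> F) (g : I' -> J' -> F) s s' :
  circ f s -> circ g s' -> circ (tensor f g) (#|I| * s' + s * #|J'|).
Proof.
move=> /(circ_tensorr J') cf /(circ_tensorl I) cg.
exact: circ_mul cg cf (tensor_factor f g).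
Qed.

(** * Passage back to matrices and [sync_circuit] *)

Lemma sync_circuit_mulr (m k n : nat) (A : 'M[F]_(m, k)) s (B : 'M[F]_(k, n)) :
  sync_circuit A s -> sync_circuit (A *m B) (s + nnz B)%N.
Proof.
move=> sA; elim: sA B => {m k A s} [m k A | m k l A C s sC IH] B.
  by apply: sc_cons; exact: sc_one.
by rewrite -mulmxA -addnA; apply: sc_cons; exact: IH.
Qed.

Lemma nnz_fnnz (I J : finType) (f : I -> J -> F) m n (r : 'I_m -> I) (c : 'I_n -> J) :
  injective r -> injective c -> (nnz (\matrix_(i, j) f (r i) (c j)) <= fnnz f)%N.
Proof.
move=> rI cI; rewrite /nnz /fnnz.
pose h (ij : 'I_m * 'I_n) := (r ij.1, c ij.2).
have hI : injective h by move=> [i j] [k l] [/rI-> /cI->].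
rewrite -(card_imset _ hI); apply/subset_leq_card/fintype.subsetP => x /imsetP[[i j]].
by rewrite !inE mxE /= => nz ->.
Qed.

(** Enumerating the inner index sets turns them into ordinals; injective [r] and [c] select entries
    without repetition, so the count cannot grow. *)
Lemma circ_sync (I J : finType) (f : I -> J -> F) s m n (r : 'I_m -> I) (c : 'I_n -> J) :
  injective r -> injective c -> circ f s ->
  exists2 s', sync_circuit (\matrix_(i, j) f (r i) (c j)) s' & (s' <= s)%N.
Proof.
move=> rI cI [d]; elim: d J f s n c cI => [|d IHd] J f s n c cI /=.
  move=> nf; eexists; first exact: sc_one.
  by apply: leq_trans nf; exact: nnz_fnnz.
move=> [K [B [C [s0 [lB sC fE]]]]].
have [s1 sB les] := IHd _ B s0 _ (@enum_val K predT) enum_val_inj lB.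
pose MC := \matrix_(k < #|K|, j < n) C (enum_val k) (c j).
exists (s1 + nnz MC)%N; last first.
  by apply: leq_trans sC; rewrite leq_add // nnz_fnnz //; exact: enum_val_inj.
have -> : \matrix_(i, j) f (r i) (c j) =
    (\matrix_(i, j) B (r i) (enum_val j)) *m MC.
  apply/matrixP => i j; rewrite !mxE fE.
  rewrite (reindex _ (onW_bij _ (@enum_val_bij K))) /=.
  by apply: eq_bigr => k _; rewrite !mxE.
exact: sync_circuit_mulr.
Qed.
End LayeredCircuits.

(** * Kronecker powers indexed by words *)

(** Nested pairs, so that one more letter in [kpow] is literally one more [tensor]. *)
Fixpoint word (L : finType) (w : nat) : finType :=
  if w is w'.+1 then (L * word L w')%type else unit.

Lemma card_word (L : finType) w : #|word L w| = (#|L| ^ w)%N.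
Proof. by elim: w => [|w IHw] /=; rewrite ?card_unit // card_prod IHw expnS. Qed.

Fixpoint wsplit (L : finType) (m n : nat) : word L (m + n) -> word L m * word L n :=
  match m with
  | 0 => fun x => (tt, x)
  | m'.+1 => fun x : L * word L (m' + n) =>
      ((x.1, (@wsplit L m' n x.2).1), (@wsplit L m' n x.2).2)
  end.

Fixpoint wjoin (L : finType) (m n : nat) : word L m * word L n -> word L (m + n) :=
  match m with
  | 0 => fun x => x.2
  | m'.+1 => fun x : (L * word L m') * word L n =>
      ((x.1.1, @wjoin L m' n (x.1.2, x.2)) : word L (m'.+1 + n))
  end.

Lemma wsplitK (L : finType) m n : cancel (@wsplit L m n) (@wjoin L m n).
Proof.
elim: m => [|m IHm] //= [a x] /=.
by rewrite -surjective_pairing IHm.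
Qed.

Fixpoint wpair (L : finType) (w : nat) : word L w.*2 -> word (L * L)%type w :=
  match w with
  | 0 => fun=> tt
  | w'.+1 => fun x : L * (L * word L w'.*2) => ((x.1, x.2.1), @wpair L w' x.2.2)
  end.

Fixpoint wunpair (L : finType) (w : nat) : word (L * L)%type w -> word L w.*2 :=
  match w with
  | 0 => fun=> tt
  | w'.+1 => fun x : (L * L) * word (L * L)%type w' =>
      ((x.1.1, (x.1.2, @wunpair L w' x.2)) : word L w'.+1.*2)
  end.

Lemma wpairK (L : finType) w : cancel (@wpair L w) (@wunpair L w).
Proof. by elim: w => [[]|w IHw [a [b x]]] //=; rewrite IHw. Qed.

Section KroneckerPower.
Context {F : fieldType}.

Fixpoint kpow (I J : finType) (f : I -> J -> F) (w : nat) : word I w -> word J w -> F :=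
  match w with
  | 0 => fun _ _ => 1
  | w'.+1 => tensor f (@kpow I J f w')
  end.
#[global] Arguments kpow {I J} f w x y.

Lemma kpow_cat (I J : finType) (f : I -> J -> F) m n x y :
  kpow f (m + n) x y = tensor (kpow f m) (kpow f n) (wsplit x) (wsplit y).
Proof.
elim: m x y => [|m IHm] x y /=; first by rewrite /tensor /= mul1r.
by case: x y => [a x] [b y]; rewrite /tensor /= IHm /tensor mulrA.
Qed.

Lemma kpow_pair (I J : finType) (f : I -> J -> F) w x y :
  kpow f w.*2 x y = kpow (tensor f f) w (wpair x) (wpair y).
Proof.
elim: w x y => [//|w IHw] [a [b x]] [c [d y]].
by rewrite /= /tensor /= IHw mulrA.
Qed.

Lemma kpow_mul (I J K : finType) (f : I -> J -> F) (B : I -> K -> F) (C : K -> J -> F) w :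
  (forall i j, f i j = \sum_k B i k * C k j) ->
  forall x y, kpow f w x y = \sum_z kpow B w x z * kpow C w z y.
Proof.
move=> fE; elim: w => [|w IHw] /= x y.
  by rewrite (big_pred1 tt) ?mulr1 // => -[].
case: x y => [i x] [j y]; rewrite /tensor /= fE IHw.
rewrite -(pair_bigA _ (fun k z => B i k * kpow B w x z * (C k j * kpow C w z y))) /=.
rewrite mulr_suml; apply: eq_bigr => k _; rewrite mulr_sumr; apply: eq_bigr => z _.
by rewrite !mulrA; congr (_ * _); rewrite mulrAC.
Qed.

Lemma fnnz_kpow (I J : finType) (f : I -> J -> F) w : fnnz (kpow f w) = (fnnz f ^ w)%N.
Proof.
elim: w => [|w IHw] /=; last by rewrite fnnz_tensor IHw expnS.
by rewrite fnnzE !big_const !card_unit /= oner_eq0.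
Qed.

(** One tensor factor per layer, each layer with [fnnz f * q ^ w.-1] entries; the extra [q ^ w] is
    the single entry of the empty power, tensored with an identity at each step. *)
Lemma circ_kpow (I J : finType) (f : I -> J -> F) q w :
  #|I| = q -> #|J| = q ->
  circ (kpow f w) (w * fnnz f * q ^ w.-1 + q ^ w).
Proof.
move=> cI cJ; elim: w => [|w IHw].
  by have := circ_one (kpow f 0); rewrite fnnz_kpow.
apply: circ_mono (circ_tensor (circ_one f) IHw).
rewrite cI card_word cJ /= expnS; case: w {IHw} => [|w] /=; last by rewrite expnS; nia.
by rewrite expn0; lia.
Qed.

Lemma circ_kpow_mul (I J K : finType) (f : I -> J -> F) (B : I -> K -> F) (C : K -> J -> F) w s s' :
  (forall i j, f i j = \sum_k B i k * C k j) ->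
  circ (kpow B w) s -> circ (kpow C w) s' -> circ (kpow f w) (s + s').
Proof. by move=> fE cB cC; apply: circ_mul cB cC (kpow_mul fE). Qed.

(** The matrix A of the overview: [None] numbers the full row, and the unit row [Some p] copies
    input [c p]. *)
Definition rowop (P L : finType) (v : L -> F) (c : P -> L) (a : option P) (k : L) : F :=
  if a is Some p then (k == c p)%:R else v k.

Lemma fnnz_rowop (P L : finType) (v : L -> F) (c : P -> L) :
  (fnnz (rowop v c) <= #|L| + #|P|)%N.
Proof.
pose full := [set (None : option P, k) | k in L].
pose units := [set (Some p, c p) | p in P].
have /subset_leq_card : [set ak | rowop v c ak.1 ak.2 != 0] \subset full :|: units.
  apply/fintype.subsetP => -[[p|] k]; rewrite !inE /=.
    case: (k =P c p) => [-> _|_]; last by rewrite eqxx.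
    by apply/orP; right; apply/imsetP; exists p.
  by move=> _; apply/orP; left; apply/imsetP; exists k.
move=> /leq_trans; apply; apply: leq_trans (leq_card_setU _ _) _.
by rewrite leq_add // leq_imset_card.
Qed.

(* A unit row costs nothing: words with first letter [Some p] go on to their next letter within
   the same layer, and only those with first letter [None] use up a layer. *)
Lemma layers_rowop_step (P L : finType) (v : L -> F) (c : P -> L) d w s1 s2 :
  injective c ->
  layers d (kpow (rowop v c) w) s1 -> layers d.+1 (kpow (rowop v c) w) s2 ->
  layers d.+1 (kpow (rowop v c) w.+1) (s1 + #|L| ^ w.+1 + #|P| * s2).
Proof.
move=> cI l1 l2; set A := rowop v c in l1 l2 *.
(* Words beginning with [None]: the input-side layer [C] contracts the first letter against [v], and
   the circuit for the tail does the rest. *)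
pose first u (y : L * word L w) := v y.1 * kpow A w u y.2.
have l1' : layers d.+1 first (s1 + #|L| ^ w.+1).
  pose C (u : word L w) (y : L * word L w) := v y.1 * idm u y.2.
  apply: (layers_cons l1 (C := C)).
    pose vrow (_ : unit) := v.
    apply: (@leq_trans (fnnz (tensor vrow (@idm F (word L w))))).
      apply: (@fnnz_reindex _ _ _ _ _ _ _ (fun u => (tt, u)) snd some id) => //.
    rewrite fnnz_tensor fnnz_idm card_word expnS leq_mul2r.
    by rewrite (leq_trans (fnnz_le_card _)) ?orbT // card_unit mul1n.
  move=> u [k y]; rewrite /first /C /=.
  by under eq_bigr do rewrite mulrCA; rewrite -mulr_sumr sum_idmr.
(* Columns of [rest] whose first letter is outside the image of [c] are zero; on the others [rest]
   consists of [#|P|] disjoint copies of the tail. *)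
pose cinv (k : L) := [pick p | c p == k].
have cinvP k p : cinv k = Some p -> c p = k.
  by rewrite /cinv; case: pickP => // p' /eqP cp' [<-].
have cinvK p : cinv (c p) = Some p.
  rewrite /cinv; case: pickP => [p' /eqP/cI->//|/(_ p)].
  by rewrite eqxx.
pose rest (x : P * word (option P) w) (y : L * word L w) := (y.1 == c x.1)%:R * kpow A w x.2 y.2.
have l2' : layers d.+1 rest (#|P| * s2).
  apply: (@layers_reindex _ _ _ _ _ _ _ rest _ id id
    (fun y => omap (fun p => (p, y.2)) (cinv y.1)) (fun z => (c z.1, z.2)))
    (layers_tensorl P l2) => // [[k y]|[p x] [k y]] /=.
    by case E: (cinv k) => [p|//] /=; rewrite (cinvP _ _ E).
  rewrite /rest /=; case E: (cinv k) => [p'|] /=.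
    by rewrite /tensor /idm /= -(cinvP _ _ E) (inj_eq cI) eq_sym.
  by case: eqP => [kE|_]; [rewrite kE cinvK in E|rewrite mul0r].
pose r (x : option P * word (option P) w) : word (option P) w + P * word (option P) w :=
  if x.1 is Some p then inr (p, x.2) else inl x.2.
pose r' (x : word (option P) w + P * word (option P) w) : option P * word (option P) w :=
  match x with inl u => (None, u) | inr z => (Some z.1, z.2) end.
apply: (@layers_reindex _ _ _ _ _ _ _ _ _ r r' some id _ _ _ (layers_stack l1' l2')) => //.
  by move=> [[p|] u].
by move=> [[p|] u] [k y].
Qed.

(** The coarse layers: each treats a block of [b] letters at once, at a factor [(#|L| + #|P|) ^ b]
    that is constant for fixed [b]. *)
Lemma layers_rowop_bounded (P L : finType) (v : L -> F) (c : P -> L) b t w :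
  (#|P| < #|L|)%N -> (w <= b * t.+1)%N ->
  layers t (kpow (rowop v c) w) (t.+1 * (#|L| + #|P|) ^ b * #|L| ^ w).
Proof.
move=> ltPL; set q := #|L|; set a := (q + #|P|)%N.
have q0 : (0 < q)%N by rewrite (leq_ltn_trans _ ltPL).
have a0 : (0 < a)%N by rewrite addn_gt0 q0.
have expl m n e : (m <= n)%N -> (m ^ e <= n ^ e)%N.
  by move=> mn; elim: e => // e IHe; rewrite !expnS leq_mul.
have nA e : (fnnz (kpow (rowop v c) e) <= a ^ e)%N.
  by rewrite fnnz_kpow expl // fnnz_rowop.
elim: t w => [|t IHt] w wb.
  rewrite muln1 in wb; rewrite /= mul1n; apply: leq_trans (nA _) _.
  by rewrite -[leqLHS]muln1 leq_mul ?expn_gt0 ?q0 // leq_pexp2l.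
(* When at most one block is left, an identity layer keeps the number of factors exact. *)
have [wb'|/ltnW bw] := leqP w b.
  have /IHt/layers_pad : (w <= b * t.+1)%N by rewrite (leq_trans wb') // leq_pmulr.
  apply: layers_mono; rewrite card_word -/q.
  have : (0 < a ^ b)%N by rewrite expn_gt0 a0.
  by move: (a ^ b)%N (q ^ w)%N => x y x0; rewrite [(t.+2 * _)%N]mulSnr mulnDl leq_add2l leq_pmull.
have wE := subnKC bw; move: (w - b)%N wE => w' wE.
have w'b : (w' <= b * t.+1)%N by rewrite -(leq_add2l b) wE -mulnS.
case: w / wE wb bw => _ _.
have lB := layers_tensorl (word (option P) b) (IHt _ w'b).
pose C := tensor (kpow (rowop v c) b) (@idm F (word L w')).
have nC : (fnnz C <= a ^ b * q ^ w')%N.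
  by rewrite fnnz_tensor fnnz_idm card_word leq_mul2r nA orbT.
have lf := layers_cons lB nC (tensor_factor (kpow (rowop v c) b) (kpow (rowop v c) w')).
have := layers_reindex (@wsplitK _ b w') (c := some \o @wsplit L b w')
  (c' := @wjoin L b w') _ (fun i j => kpow_cat (rowop v c) i j) lf.
move=> /(_ (@wsplitK _ _ _)); apply: layers_mono.
rewrite card_word card_option expnD.
(* Output prefixes are no more numerous than input prefixes, so repeating the shorter circuit for
   each prefix stays within the bound. *)
have lePL : (#|P|.+1 ^ b <= q ^ b)%N by rewrite expl.
have q1 : (1 <= q ^ b)%N by rewrite expn_gt0 q0.
move: (_ ^ b)%N lePL => x1 lePL; move: (q ^ b)%N q1 lePL => x2 q1 lePL.
move: (a ^ b)%N (q ^ w')%N => x3 x4.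
have -> : (t.+2 * x3 * (x2 * x4) = x2 * (t.+1 * x3 * x4) + x2 * (x3 * x4))%N by nia.
by apply: leq_add; [rewrite leq_mul | rewrite leq_pmull].
Qed.
End KroneckerPower.

(** * The adaptive circuit for a row operation *)

Lemma big_option (R : Type) (idx : R) (op : Monoid.com_law idx) (P : finType) (h : option P -> R) :
  \big[op/idx]_k h k = op (h None) (\big[op/idx]_p h (Some p)).
Proof.
rewrite (bigD1 None) //=; congr (op _ _).
rewrite (reindex_omap Some id) => [|[p|]] //=.
by apply: eq_bigl => p; rewrite eqxx.
Qed.

Section Rates.
Context {R : realFieldType} {F : fieldType}.

Lemma layers_kpow0 (I J : finType) (f : I -> J -> F) d : layers d (kpow f 0) d.+1.
Proof.
elim: d => [|d IHd]; first by have := fnnz_kpow f 0; rewrite /= => ->.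
by have := layers_pad IHd; rewrite card_unit addn1.
Qed.

(* Since [4 x y = 1 + 3 y] for [x = 9/8] and [y = 2/3], the right-hand side satisfies with
   equality the recurrence [S (w+1) (J+1) = 4^(w+1) + S w J + 3 S w (J+1)]. *)
Lemma layers_rowop_rate (P L : finType) (v : L -> F) (c : P -> L) b t J w :
  #|P| = 3%N -> #|L| = 4%N -> injective c -> (w <= b * t.+1)%N ->
  exists2 s, layers (J + t) (kpow (rowop v c) w) s &
    (s%:R : R) <= 4 ^+ w * (3 / 4 * w%:R + J%:R + t.+1%:R +
                    t.+1%:R * 7 ^+ b * ((9 / 8) ^+ w * (2 / 3) ^+ J)).
Proof.
move=> cP cL cI; set K := t.+1%:R * 7 ^+ b : R.
have K0 : 0 <= K by rewrite mulr_ge0 ?exprn_ge0.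
have y0 j : 0 <= (2 / 3) ^+ j :> R by apply: exprn_ge0; lra.
have x0 j : 0 <= (9 / 8) ^+ j :> R by apply: exprn_ge0; lra.
elim: w J => [|w IHw] J wb.
  exists (J + t).+1; first exact: layers_kpow0.
  rewrite !expr0 mulr0 add0r !mul1r -addnS natrD lerDl.
  by rewrite mulr_ge0.
case: J => [|J].
  (* No adaptive layer is left, so the coarse layers treat all words. *)
  exists (t.+1 * (#|L| + #|P|) ^ b * #|L| ^ w.+1)%N.
    by apply: layers_rowop_bounded; rewrite ?cP ?cL.
  rewrite cP cL !natrM !natrX -/K expr0 mulr1 mulrC ler_pM2l ?exprn_gt0 //.
  have x1 : 1 <= (9 / 8) ^+ w.+1 :> R by rewrite exprn_ege1 //; lra.
  have : K <= K * (9 / 8) ^+ w.+1 by rewrite ler_peMr.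
  have : 0 <= w.+1%:R :> R by rewrite ler0n.
  have : 0 <= t.+1%:R :> R by rewrite ler0n.
  by lra.
have [s1 l1 b1] := IHw J (ltnW wb).
have [s2 l2 b2] := IHw J.+1 (ltnW wb).
exists (s1 + #|L| ^ w.+1 + #|P| * s2)%N; first exact: layers_rowop_step l1 l2.
rewrite 2!natrD natrM natrX cP cL.
apply: (le_trans (lerD (lerD b1 (lexx _)) (ler_wpM2l _ b2))) => //.
rewrite !exprS -[w.+1%:R]natr1 -[J.+1%:R]natr1.
by lra.
Qed.

(** Absorbs the factor [t.+1] due to the coarse layers. The bound 40 survives a step because 97/100
    of 41 is below 40. *)
Lemma geometric_bound (q : R) t : 0 <= q <= 97 / 100 -> t.+1%:R * q ^+ t <= 40.
Proof.
move=> /andP[q0 q1]; elim: t => [|t IHt]; first by rewrite expr0 mulr1; lra.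
have qt0 : 0 <= q ^+ t by rewrite exprn_ge0.
have qt1 : q ^+ t <= 1 by rewrite exprn_ile1 //; lra.
rewrite -natr1 exprS.
have -> : (t.+1%:R + 1) * (q * q ^+ t) = q * (t.+1%:R * q ^+ t + q ^+ t) by ring.
apply: (@le_trans _ _ (97 / 100 * (40 + 1))); last by lra.
by apply: ler_pM => //; [rewrite addr_ge0 // mulr_ge0 | rewrite lerD].
Qed.

(** Take 15 (t + 1) adaptive layers and t + 1 coarse ones: in units of the word count, the linear
    part is (75/2 + 15 + 1) t + 16. The base 7 is [#|L| + #|P|]. *)
Lemma circ_rowop_rate (P L : finType) (v : L -> F) (c : P -> L) t :
  #|P| = 3%N -> #|L| = 4%N -> injective c ->
  exists2 s, circ (kpow (rowop v c) (50 * t)) s &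
    (s%:R : R) <= 4 ^+ (50 * t) * (107 / 2 * t%:R + (16 + 7 ^+ 50 * 40)).
Proof.
move=> cP cL cI.
have wb : (50 * t <= 50 * t.+1)%N by rewrite leq_mul.
have [s ls sb] := @layers_rowop_rate P L v c 50 t (15 * t.+1) (50 * t) cP cL cI wb.
exists s; first by exists (15 * t.+1 + t)%N.
apply: le_trans sb _; rewrite ler_wpM2l ?exprn_ge0 //.
rewrite [leRHS]addrA lerD //.
  by rewrite !natrM -natr1; lra.
rewrite [_ * 7 ^+ 50]mulrC -mulrA ler_wpM2l ?exprn_ge0 //.
(* A Chernoff bound: if a uniform word has N full-row letters, the mean of (3/2)^N is (9/8)^w, so
   (9/8)^w (2/3)^J bounds the share of words with N >= J. For J = 3w/10, every 10 letters contribute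
   a factor [q]. *)
pose q : R := (9 / 8) ^+ 10 * (2 / 3) ^+ 3.
have q01 : 0 <= q <= 97 / 100 by rewrite /q; lra.
have /andP[q0 q1] := q01.
have qt0 : 0 <= q ^+ t by rewrite exprn_ge0.
have qt1 : q ^+ t <= 1 by rewrite exprn_ile1 //; lra.
apply: le_trans (geometric_bound t q01); rewrite ler_wpM2l //.
have -> : (9 / 8) ^+ (50 * t) * (2 / 3) ^+ (15 * t.+1) = (2 / 3) ^+ 15 * (q ^+ t) ^+ 5 :> R.
  rewrite mulnS exprD mulrCA -exprM; congr (_ * _).
  by rewrite /q [(t * 5)%N]mulnC !exprM -exprMn; congr (_ ^+ t); field.
apply: (@le_trans _ _ ((q ^+ t) ^+ 5)).
  by rewrite ler_piMl ?exprn_ge0 // exprn_ile1 //; lra.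
by rewrite exprS ler_piMr // exprn_ile1.
Qed.
End Rates.

(** * Kronecker powers of 2 x 2 matrices *)

Definition pivot (p : option bool) : bool * bool := if p is Some b then (b, ~~ b) else (true, true).

Lemma pivot_inj : injective pivot.
Proof. by move=> [[]|] [[]|]. Qed.

(* For [f = [[a, b], [c, d]]], the matrix [f (x) f] is a rank one matrix [u v^T] plus a
   generalized permutation matrix supported on the pairs [(x, y), (~~ y, ~~ x)].  The left factor
   reads the value of [v^T] and the inputs other than number [(false, false)], which is recovered
   from that value: three rows have 2 nonzero entries and one has 4. *)
Lemma tensor_square_factor (F : fieldType) (f : bool -> bool -> F) :
  (forall x y, f x y != 0) ->
  exists (v : bool * bool -> F) (B : bool * bool -> option (option bool) -> F),
    (fnnz B <= 10)%N /\
    forall i j, tensor f f i j = \sum_k B i k * rowop v pivot k j.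
Proof.
move=> nz; set a := f false false; set b := f false true.
set c := f true false; set d := f true true.
have [a0 b0 c0] : [/\ a != 0, b != 0 & c != 0] by rewrite !nz.
pose v (x : bool * bool) : F :=
  match x with (false, false) => a ^+ 2 | (true, true) => a * b * d / c | _ => a * b end.
(* Row [(true, true)] needs the correction c^2 - a c d / b in column [(false, false)]; that input is
   the value of [v^T] minus its other terms, divided by a^2. *)
pose e : F := (c ^+ 2 - a * c * d / b) / a ^+ 2.
pose B (i : bool * bool) (k : option (option bool)) : F :=
  match i, k with
  | (false, false), None => 1
  | (false, false), Some None => b ^+ 2 - a * b * d / c
  | (false, false), Some (Some _) => 0
  | (true, true), None => c * d / (a * b) + e
  | (true, true), Some p => - e * v (pivot p)
  | (x, _), None => c / a
  | (x, _), Some (Some y) => if x == y then a * d - b * c else 0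
  | (x, _), Some None => 0
  end.
exists v, B; split.
  (* An upper bound for the support, since entries such as a d - b c may vanish; its rows have sizes
     2, 2, 2 and 4. *)
  pose supp (i : bool * bool) (k : option (option bool)) : bool :=
    match i, k with
    | (true, true), _ | _, None => true
    | (false, false), Some p => p == None
    | (x, _), Some p => p == Some x
    end.
  rewrite fnnzE; apply: (@leq_trans (\sum_i \sum_k supp i k)).
    apply: leq_sum => i _; apply: leq_sum => k _.
    by case: i k => [[] []] [[[]|]|] /=; rewrite ?eqxx ?leq_b1.
  have -> : (\sum_i \sum_k supp i k = \sum_x \sum_y \sum_k supp (x, y) k)%N.
    by rewrite [RHS]pair_bigA; apply: eq_bigr => -[].
  by rewrite !big_bool /= !big_option /= !big_bool.
move=> [i1 i2] [j1 j2]; rewrite /tensor /= !big_option !big_bool /=.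
by case: i1 i2 j1 j2 => [] [] [] []; rewrite /= -/a -/b -/c -/d /e ?eqxx /=;
  field; rewrite ?a0 ?b0 ?c0.
Qed.

Lemma circ_kpow_bool (R : realFieldType) (F : fieldType) (f : bool -> bool -> F) :
  exists C : R, forall n, exists2 s, circ (kpow f n) s &
    (s%:R : R) <= (357 / 200 * n%:R + C) * 2 ^+ n.
Proof.
(* One tensor factor per layer: used for all factors if some entry is zero, and otherwise for the
   fewer than 100 factors left over. *)
have bits m k : (fnnz f <= m)%N -> exists2 s, circ (kpow f k) s &
    (s%:R : R) <= (m%:R / 2 * k%:R + 1) * 2 ^+ k.
  move=> fm; exists (k * fnnz f * 2 ^ k.-1 + 2 ^ k)%N.
    by apply: circ_kpow; rewrite card_bool.
  rewrite natrD mulrDl mul1r natrX lerD2r.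
  case: k => [|k]; first by rewrite !mul0n mulr0 mul0r.
  rewrite natrM natrX natrM exprS /=.
  have : (fnnz f)%:R <= m%:R :> R by rewrite ler_nat.
  move: (fnnz f)%:R => x xm.
  rewrite (_ : _ * (2 * _) = k.+1%:R * m%:R * 2 ^+ k); last by field.
  by rewrite ler_wpM2r ?exprn_ge0 // ler_wpM2l.
have [/forallP nz|/forallPn[x /forallPn[y]]] := boolP [forall x, forall y, f x y != 0]; last first.
  rewrite negbK => fxy0.
  have f3 : (fnnz f <= 3)%N.
    have : (fnnz f <= #|[set~ (x, y)]|)%N.
      apply/subset_leq_card/fintype.subsetP => -[i j]; rewrite !inE.
      by apply: contraNneq => -[-> ->].
    by rewrite cardsC1 card_prod card_bool.
  exists 1 => n; have [s cs sb] := bits 3%N n f3; exists s => //.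
  apply: le_trans sb _; rewrite ler_wpM2r ?exprn_ge0 // lerD2r.
  by have : 0 <= n%:R :> R by []; lra.
have {}nz x y : f x y != 0 by apply: (forallP (nz x)).
have [v [B [nB fE]]] := tensor_square_factor nz.
have nf : (fnnz f <= 4)%N by rewrite (leq_trans (fnnz_le_card _)) // card_bool.
(* With n = 100 t + r, the first 100 t factors form 50 t pairs and the last r <= 99 cost at most 2 r
   + 1 <= 199 each per unit of size. [C0] adds to the constant of [circ_rowop_rate] the 1 coming
   from the power of [B]. *)
pose C0 : R := 17 + 7 ^+ 50 * 40.
exists (C0 + 200) => n; set t := (n %/ 100)%N; set r := (n %% 100)%N.
have [s1 c1 b1] := bits 4%N r nf.
have [||s2 c2 b2] := @circ_rowop_rate R F _ _ v pivot t _ _ pivot_inj.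
- by rewrite !card_option card_bool.
- by rewrite card_prod card_bool.
pose w := (50 * t)%N.
have cB : circ (kpow B w) (w * 10 * 4 ^ w.-1 + 4 ^ w).
  have : circ (kpow B w) (w * fnnz B * 4 ^ w.-1 + 4 ^ w).
    by apply: circ_kpow; rewrite ?card_prod ?card_option card_bool.
  by apply: circ_mono; rewrite leq_add2r leq_mul2r leq_mul2l nB !orbT.
have c3 := circ_kpow_mul fE cB c2.
have c4 : circ (kpow f w.*2) (w * 10 * 4 ^ w.-1 + 4 ^ w + s2).
  apply: circ_reindex (@wpairK _ _) (@wpairK _ _) _ c3.
  exact: kpow_pair.
have c5 := circ_tensor c4 c1.
have nE : (w.*2 + r)%N = n by rewrite /w -muln2 [n](divn_eq n 100) /t /r; lia.
exists (#|word bool w.*2| * s1 + (w * 10 * 4 ^ w.-1 + 4 ^ w + s2) * #|word bool r|)%N.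
  rewrite -nE; apply: circ_reindex (@wsplitK _ _ _) (@wsplitK _ _ _) _ c5.
  exact: kpow_cat.
have wE : (w * 10 * 4 ^ w.-1)%:R = 5 / 2 * w%:R * 4 ^+ w :> R.
  case: (w) => [|w']; first by rewrite !mul0n mulr0 mul0r.
  by rewrite !natrM natrX exprS /=; field.
have -> : n%:R = 100 * t%:R + r%:R :> R by rewrite [in LHS](divn_eq n 100) natrD natrM mulrC.
have w2 : 2 ^+ w.*2 = 4 ^+ w :> R by rewrite -mul2n exprM; congr (_ ^+ _); ring.
rewrite !card_word card_bool natrD !natrM !natrX natrD natrD wE natrX w2.
have -> : 2 ^+ n = 4 ^+ w * 2 ^+ r :> R by rewrite -[in LHS]nE exprD w2.
have : r%:R <= 99 :> R by rewrite ler_nat -ltnS ltn_pmod.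
have : 0 <= r%:R :> R by [].
have wt : w%:R = 50 * t%:R :> R by rewrite natrM.
rewrite -/w in b2; rewrite wt; move: b1 b2.
have W0 : 0 <= 4 ^+ w :> R by rewrite exprn_ge0.
have r0 : 0 <= 2 ^+ r :> R by rewrite exprn_ge0.
move: s1%:R s2%:R (4 ^+ w) (2 ^+ r) r%:R t%:R W0 r0 => x1 x2 W Q u z W0 Q0 b1 b2 u0 u99.
have : W * x1 <= W * (199 * Q).
  rewrite ler_wpM2l //; apply: le_trans b1 _; rewrite ler_wpM2r //; lra.
have : x2 * Q <= W * (107 / 2 * z + (16 + 7 ^+ 50 * 40)) * Q by rewrite ler_wpM2r.
have : 0 <= u * (W * Q) by rewrite !mulr_ge0.
have : 0 <= W * Q by rewrite mulr_ge0.
by rewrite /C0; move: (7 ^+ 50) => c7; lra.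
Qed.

(** * From words to matrix indices *)

Fixpoint word_of_nat (n i : nat) : word bool n :=
  match n with 0 => tt | n'.+1 => (odd i, word_of_nat n' i./2) end.

Lemma word_of_nat_inj n i j :
  (i < 2 ^ n)%N -> (j < 2 ^ n)%N -> word_of_nat n i = word_of_nat n j -> i = j.
Proof.
elim: n i j => [|n IHn] i j; first by rewrite expn0 !ltnS !leqn0 => /eqP-> /eqP->.
rewrite expnS => ilt jlt [oij /IHn hij].
by rewrite -(odd_double_half i) -(odd_double_half j) oij hij //; lia.
Qed.

(** Digit 0 is the head letter, so removing the heads halves both indices and shifts the product by
    one. *)
Lemma kron_pow_kpow (F : fieldType) (M : 'M[F]_2) n :
  kron_pow M n = \matrix_(i, j) kpow (fun x y : bool => M (inord x) (inord y)) n
                                  (word_of_nat n i) (word_of_nat n j).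
Proof.
apply/matrixP => i j; rewrite !mxE; move: (nat_of_ord i) (nat_of_ord j) => {}i {}j.
elim: n i j => [|n IHn] i j; first by rewrite big_ord0.
rewrite big_ord_recl /= /tensor /= -IHn /bit !divn1; congr (_ * _).
apply: eq_bigr => k _.
by rewrite /bump /= add1n expnS !divnMA !divn2.
Qed.

Lemma sync_circuit_kron_pow (R : realFieldType) (F : fieldType) (M : 'M[F]_2) :
  exists C : R, forall n, exists s, sync_circuit (kron_pow M n) s /\
    s%:R <= (357 / 200 * n%:R + C) * 2 ^+ n.
Proof.
have [C HC] := circ_kpow_bool R (fun x y : bool => M (inord x) (inord y)).
exists C => n; have [s cs sb] := HC n.
have inj : injective (fun i : 'I_(2 ^ n) => word_of_nat n i).
  by move=> i j /word_of_nat_inj ij; apply/val_inj/ij.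
have [s' ss' les] := circ_sync inj inj cs.
exists s'; split; first by rewrite kron_pow_kpow.
by apply: le_trans sb; rewrite ler_nat.
Qed.

(** * Numerical bounds and the main theorem *)

(* [expR x >= (1 + x / 2 ^ k) ^ (2 ^ k)], evaluated by repeated squaring with rounding. *)
Lemma expR_ge_path (R : realType) (x a : R) (s : seq R) :
  a <= 1 + x / 2 ^+ size s ->
  path (fun y z => (0 <= y) && (z <= y ^+ 2)) a s -> last a s <= expR x.
Proof.
elim/last_ind: s x a => [|s b IHs] x a /=.
  by rewrite expr0 divr1 => /le_trans + _; apply; exact: expR_ge1Dx.
rewrite size_rcons rcons_path last_rcons => ale /andP[ps /andP[l0 lb]].
have {}IHs : last a s <= expR (x / 2).
  by apply: IHs ps; rewrite -mulrA -invfM -exprS.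
have -> : x = 2%:R * (x / 2) by field.
rewrite expRM_natl; apply: le_trans lb _.
by rewrite ler_pXn2r // nnegrE ?expR_ge0.
Qed.

Lemma expR1_ge (R : realType) : 2716 / 1000 <= expR 1 :> R.
Proof.
(* [d] reads decimals in groups of three. The list squares 1 + 1/2^10 ten times, rounding down each
   time. *)
pose d (i j k l : nat) : R := i%:R + j%:R / 10 ^+ 3 + k%:R / 10 ^+ 6 + l%:R / 10 ^+ 9.
apply: (@expR_ge_path R 1 (d 1 0 976 562)
  [:: d 1 1 954 77; d 1 3 911 972; d 1 7 839 247; d 1 15 739 947; d 1 31 727 639; d 1 64 461 921;
      d 1 133 79 181; d 1 283 868 430; d 1 648 318 145; 2716 / 1000]);
  rewrite /= /d; first by lra.
by do ![apply/andP; split] => //; lra.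
Qed.

(** An upper bound 2 on the exponential of 0.6922 becomes a lower bound 1/2 at -0.6922, where
    repeated squaring from below applies. *)
Lemma ln2_ge (R : realType) : 6922 / 10000 <= ln 2 :> R.
Proof.
rewrite -ler_expR lnK ?posrE // -[leRHS]invrK -[leLHS]invrK -expRN.
rewrite lef_pV2 ?posrE ?expR_gt0 ?invr_gt0 //.
pose d (i j k l : nat) : R := i%:R + j%:R / 10 ^+ 3 + k%:R / 10 ^+ 6 + l%:R / 10 ^+ 9.
apply: (@expR_ge_path R _ (d 0 999 324 23)
  [:: d 0 998 648 502; d 0 997 298 830; d 0 994 604 956; d 0 989 239 18; d 0 978 593 834;
      d 0 957 645 891; d 0 917 85 652; d 0 841 46 93; d 0 707 358 530; 2^-1]);
  rewrite /= /d; first by lra.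
by do ![apply/andP; split] => //; lra.
Qed.

Local Open Scope classical_set_scope.
Local Open Scope ring_scope.

Theorem theorem1p5 (R : realType) (F : fieldType) (M : 'M[F]_2) :
  (exists (eps : R) (o : nat -> R),
     1526 / 10 ^+ 5 < eps /\ o @ \oo --> (0 : R) /\
     forall n : nat, (0 < n)%N ->
       exists s : nat, sync_circuit (kron_pow M n) s /\
         (s%:R : R) <= ((1 - eps) * expR 1 * ln 2 + o n) * (2 ^ n * n)%:R) /\
  (exists (eps : R) (o : nat -> R),
     4816 / 10 ^+ 5 < eps /\ o @ \oo --> (0 : R) /\
     forall n : nat, (0 < n)%N ->
       exists s : nat, sync_circuit (kron_pow (H1 F) n) s /\
         (s%:R : R) <= ((1 - eps) * expR 1 * ln 2 + o n) * (2 ^ n * n)%:R).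
Proof.
(* The product of 2.716, 0.6922 and 0.95 exceeds 1.785. The value 1/20 serves both claims, being
   above 0.04816. *)
have rate : 357 / 200 <= (1 - 1 / 20) * expR 1 * ln 2 :> R.
  have : 2716 / 1000 * (6922 / 10000) <= expR 1 * ln 2 :> R.
    by apply: ler_pM (expR1_ge R) (ln2_ge R); lra.
  by rewrite -mulrA; lra.
have main (A : 'M[F]_2) : exists o : nat -> R, o @ \oo --> (0 : R) /\
    forall n : nat, (0 < n)%N -> exists s : nat, sync_circuit (kron_pow A n) s /\
      (s%:R : R) <= ((1 - 1 / 20) * expR 1 * ln 2 + o n) * (2 ^ n * n)%:R.
  have [C HC] := sync_circuit_kron_pow R A.
  (* The lower-order term C 2^n is C / n times 2^n n. *)
  exists (fun n => C * n%:R^-1); split.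
    suff : C * n.+1%:R^-1 @[n --> \oo] --> C * 0.
      by rewrite mulr0 => lim0; rewrite -cvg_shiftS; exact: lim0.
    by apply: cvgMl_tmp; exact: cvg_harmonic.
  move=> n n0; have [s [cs sb]] := HC n; exists s; split=> //.
  apply: le_trans sb _; rewrite natrM natrX mulrCA [leRHS]mulrC ler_wpM2r ?exprn_ge0 //.
  have n1 : 0 < n%:R :> R by rewrite ltr0n.
  by rewrite [leRHS]mulrDl divfK ?gt_eqF // lerD2r ler_wpM2r // ltW.
by split; [case: (main M) => o [lim0 Ho] | case: (main (H1 F)) => o [lim0 Ho]];
  exists (1 / 20), o; split=> //; lra.
Qed.
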